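(* Let $L$ be a finite rank uniform geometric lattice. Then the chain polynomial of any $L$-paving lattice $Q$ is real-rooted, and all of its zeros lie in the interval $[-1,0]$. Moreover, if $S$ is a set of nonnegative integers, then the chain polynomial of the rank selected subposet $Q_S$ is real-rooted with all zeros in $[-1,0]$.
   Context: The chain polynomial of a finite poset $P$ is $c_P=\sum_{k\ge 0}c_k(P)t^k$, where $c_k(P)$ is the number of $k$-element chains of $P$. A geometric lattice is a semimodular lattice (graded, with rank function $\rho$ satisfying $\rho(x)+\rho(y)\ge\rho(x\wedge y)+\rho(x\vee y)$) that is atomistic. A graded poset $L$ with least element $\hat 0$ is rank uniform if for all $x,y$ with $\rho(x)=\rho(y)$ and all $0\le k\le\rho(x)$, $|\{z\le x:\rho(z)=k\}|=|\{z\le y:\rho(z)=k\}|$. Let $L$ be a finite geometric lattice with rank function $\rho$ and greatest element $\hat 1$, and let $1\le d<\rho(\hat 1)$. A subset $\mathcal{H}\subseteq L$ is a generalized $d$-partition of $L$ if: (i) $\hat 1\notin\mathcal{H}$; (ii) $\rho(h)\ge d$ for all $h\in\mathcal{H}$; (iii) $\mathcal{H}$ is an antichain; (iv) for each $x\in L$ with $\rho(x)=d$ there exists a unique $h\in\mathcal{H}$ such that $x\le h$. The poset $L(\mathcal{H},\hat 1,d)$ is the set $\{x\in L:\rho(x)\le d-1\}\cup\mathcal{H}\cup\{\hat 1\}$ with the order induced from $L$; it is a geometric lattice of rank $d+1$, in which $\mathcal{H}$ is the set of elements of rank $d$. An $L$-paving lattice is a lattice of the form $L(\mathcal{H},\hat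 1,d)$, with $\mathcal{H}$ a generalized $d$-partition of $L$. For a graded poset $Q$ with rank function $\rho'$ and a set $S$ of nonnegative integers, $Q_S=\{x\in Q:\rho'(x)\in S\}$ with the induced order. *)

(* Defs.v *)
From HB Require Import structures.
From mathcomp Require Import all_boot all_order all_algebra.
From mathcomp Require Import reals complex.

Set Implicit Arguments.
Unset Strict Implicit.
Unset Printing Implicit Defensive.

Import Order.TTheory GRing.Theory Num.Theory.

Local Open Scope order_scope.

(* Subposets of a finite poset T are represented by their underlying sets
   A : {set T}, with the order induced from T. *)

Section Posets.
Context {disp : Order.disp_t} {T : finPOrderType disp}.
Implicit Types (A C : {set T}) (x y : T).

Definition chain C : bool := [forall x in C, forall y in C, x >=< y].

Definition antichain A : Prop :=
  forall x y, x \in A -> y \in A -> x <= y -> x = y.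

Definition num_chains A (k : nat) : nat :=
  #|[set C : {set T} | [&& C \subset A, chain C & #|C| == k]]|.

(* A chain of A has at most #|A| elements, so no term is truncated. *)
Definition chain_poly (R : nzRingType) A : {poly R} :=
  (\poly_(k < #|A|.+1) (num_chains A k)%:R)%R.

Definition minimal_in A x : Prop :=
  x \in A /\ forall z, z \in A -> ~~ (z < x).

Definition covered_in A x y : Prop :=
  [/\ x \in A, y \in A, x < y & forall z, z \in A -> ~~ (x < z < y)].

(* rho is a rank function of the subposet A, which is thereby graded. Such a
   rho is unique on A; its values outside A are irrelevant. *)
Definition rank_function A (rho : T -> nat) : Prop :=
  (forall x, minimal_in A x -> rho x = 0%N) /\
  (forall x y, covered_in A x y -> rho y = (rho x).+1).

Definition rank_select A (rho : T -> nat) (S : pred nat) : {set T} :=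
  [set x in A | S (rho x)].

Definition rank_uniform (rho : T -> nat) : Prop :=
  forall x y, rho x = rho y -> forall k : nat, (k <= rho x)%N ->
    #|[set z | z <= x & rho z == k]| = #|[set z | z <= y & rho z == k]|.

End Posets.

Section Lattices.
Context {disp : Order.disp_t} {L : finTBLatticeType disp}.
Implicit Types (rho : L -> nat) (H Q : {set L}).

Definition atom (a : L) : Prop := covered_in [set: L] \bot a.

Definition atomistic : Prop :=
  forall x : L, exists A : {set L},
    (forall a, a \in A -> atom a) /\ x = \join_(a in A) a.

Definition semimodular rho : Prop :=
  forall x y : L, (rho (x `&` y) + rho (x `|` y) <= rho x + rho y)%N.

Definition geometric_lattice rho : Prop :=
  [/\ rank_function [set: L] rho, semimodular rho & atomistic].

Definition generalized_partition rho (d : nat) H : Prop :=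
  [/\ \top \notin H,
      forall h, h \in H -> (d <= rho h)%N,
      antichain H
    & forall x, rho x = d -> exists! h, h \in H /\ x <= h].

(* The underlying set of L(H, 1, d). *)
Definition paving_set rho (d : nat) H : {set L} :=
  [set x | (rho x <= d.-1)%N] :|: H :|: [set \top].

Definition paving_lattice rho Q : Prop :=
  exists (d : nat) (H : {set L}),
    [/\ (1 <= d < rho \top)%N, generalized_partition rho d H
      & Q = paving_set rho d H].

End Lattices.

Section Roots.
Context {R : realType}.
Local Open Scope ring_scope.
Local Open Scope complex_scope.

Definition real_rooted (p : {poly R}) : Prop :=
  forall z : R[i], root (map_poly (real_complex R) p) z -> complex.Im z = 0.

Definition zeros_between (a b : R) (p : {poly R}) : Prop :=
  forall x : R, root p x -> a <= x <= b.

End Roots.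

(* Main.v *)
Require Import Defs.
From mathcomp Require Import all_boot all_order all_algebra.
From mathcomp Require Import reals complex.
From mathcomp Require Import zify ring lra.

(** Call the elements of L flats and those of the generalized partition H blocks.
Write d = n + 1 for the rank of the blocks in the paving lattice, N for the rank
of L, and f_m for the number of atoms below a flat of rank m. Counting pairs (flat y, atom not
below y) in two ways shows that the number of flats of rank k below a flat of
rank m is b_k(f_m), where b_k(y) = prod_(i < k) (y - f_i) / (f_k - f_i) is the
Newton basis at the nodes f_0 < f_1 < ... (count_below_newton).

Fix a number t and the set S of selected ranks. Let A_0 = 1 and, for m >= 1, let
A_m be the weighted number of chains with largest element a given flat x of
rank m, all of whose ranks are positive and in S, a k-chain having weight t^k.
Then A_m = t * sum_(k < m) b_k(f_m) A_k if m is in S, and A_m = 0 otherwise.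
Removing the least and the greatest element of a paving lattice only divides
the chain polynomial by powers of 1 + t, and what remains has chain polynomial

  sum_(k < d) b_k(f_N) A_k + t * sum_h sum_(k < d) b_k(f_(rho h)) A_k,

h running over the blocks (the second term being absent if d is not selected).

Newton's backward interpolation formula rewrites the polynomial
sum_(k <= n) b_k(y) A_k in y in terms of its divided differences over
f_n, f_(n-1), ..., f_(n-j), suitably normalised; these are the numbers
layer n j, and the coefficients, backward n j y, are nonnegative at y = f_m for
m >= n (newton_layer). With v_j = backward n j (f_(n+1)) * layer n j the layers
obey the recursion

  layer (n+1) k = t * sum_(j < k) v_j + (1 + t) * sum_(j >= k) v_j

when n + 1 is in S, and layer (n+1) k = sum_(j >= k) v_j otherwise. Such
recursions are known to preserve interlacing. Instead of interlacing polynomials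
a fixed t with positive imaginary part is used: the numbers layer n 0, ...,
layer n n, apart from zeros, have increasing arguments, all in a sector of
opening arg (t / (1 + t)) (spread, layer_spread). A sector is a pointed cone, so that a nonnegative
combination with a nonzero first term does not vanish.

The blocks contribute the coefficients a_j + t W_j, where a_j = backward n j f_N
and W_j = sum_h backward n j f_(rho h). As f_(rho h) <= f_N, the quotients
W_j / a_j decrease with j, which is what keeps the combination from vanishing in
the upper half-plane (spread_mix_neq0). As each flat of rank d is below exactly
one block, sum_h b_d(f_(rho h)) = b_d(f_N); this gives W_n >= a_n, hence
W_j >= a_j for all j, and writing a_j + t W_j = a_j (1 + t) + (W_j - a_j) t
exhibits nonnegative coefficients. With t real and t (1 + t) > 0, the same
recursion then has constant sign (layer_pos). So the zeros are real and lie in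
[-1, 0]. *)

Set Implicit Arguments.
Unset Strict Implicit.
Unset Printing Implicit Defensive.

Import Order.TTheory GRing.Theory Num.Theory.

Local Open Scope ring_scope.

(** * Vectors in a sector of the complex plane *)

Section Sector.

Variables (C : numClosedFieldType) (t u : C).
Hypothesis tu_gt0 : 0 < 'Im (t * u^*).

(** With x = t / u in the upper half-plane, and for nonzero v and w: the argument
of w exceeds that of v by at least 0 and at most arg x. Both conditions are real
bilinear, so that they pass to sums; with w = 0 or v = 0 they hold trivially. *)
Definition precedes (v w : C) : Prop :=
  0 <= 'Im (w * v^*) /\ 0 <= 'Im (t * u^* * (v * w^*)).

Definition spread (m : nat) (v : nat -> C) : Prop :=
  forall i j, (i <= j < m)%N -> precedes (v i) (v j).

Lemma Im_ge0_scale (a z : C) : 0 <= a -> 0 <= 'Im z -> 0 <= 'Im (a * z).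
Proof. by move=> a0 z0; rewrite ImMl ?ger0_real// mulr_ge0. Qed.

Lemma Im_ge0_add (x y : C) : 0 <= 'Im x -> 0 <= 'Im y -> 0 <= 'Im (x + y).
Proof. by move=> x0 y0; rewrite raddfD addr_ge0. Qed.

Lemma Im_ge0_rewrite (y x : C) : x = y -> 0 <= 'Im y -> 0 <= 'Im x.
Proof. by move=> ->. Qed.

Lemma Im_real_sum (z : C) : 'Im (z + z^*) = 0.
Proof. by rewrite ImE rmorphD /= conjCK (addrC z^*) subrr mulr0 mul0r. Qed.

Lemma precedes_refl v : precedes v v.
Proof.
split; first by rewrite (Creal_ImP _ _) // ger0_real // mul_conjC_ge0.
by rewrite mulrC Im_ge0_scale ?mul_conjC_ge0 // ltW.
Qed.

Lemma precedes_sum I J (r : seq I) (s : seq J) (P : pred I) (Q : pred J) v w :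
    (forall i j, P i -> Q j -> precedes (v i) (w j)) ->
  precedes (\sum_(i <- r | P i) v i) (\sum_(j <- s | Q j) w j).
Proof.
move=> vw; split.
  rewrite rmorph_sum mulr_suml raddf_sum sumr_ge0 // => j Qj.
  rewrite mulr_sumr raddf_sum sumr_ge0 // => i Pi.
  by case: (vw i j Pi Qj).
rewrite rmorph_sum mulr_suml mulr_sumr raddf_sum sumr_ge0 // => i Pi.
rewrite !mulr_sumr raddf_sum sumr_ge0 // => j Qj.
by case: (vw i j Pi Qj).
Qed.

Lemma precedes_scale a b v w :
  0 <= a -> 0 <= b -> precedes v w -> precedes (a * v) (b * w).
Proof.
move=> a0 b0 [vw wv]; have ab0 := mulr_ge0 a0 b0.
have aC : a^* = a by rewrite geC0_conj.
have bC : b^* = b by rewrite geC0_conj.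
split; rewrite rmorphM /= ?aC ?bC.
  apply: (@Im_ge0_rewrite (a * b * (w * v^*))); first by ring.
  exact: Im_ge0_scale.
apply: (@Im_ge0_rewrite (a * b * (t * u^* * (v * w^*)))); first by ring.
exact: Im_ge0_scale.
Qed.

Lemma precedes_drop B D : precedes B D -> precedes (B + D) D.
Proof.
move=> [BD DB]; have [DD DD'] := precedes_refl D.
split; rewrite ?rmorphD ?mulrDr ?mulrDl ?mulrDr; exact: Im_ge0_add.
Qed.

(** This is the inductive step: after scaling by u, the parts that move from the
factor u to the factor t are rotated by arg x, from below the rest to above it.
Both imaginary parts expand into manifestly nonnegative terms; the only subtle
ones are |B|^2 and |t A + u D|^2 times Im (t * conj u), in which products of
indefinite sign have been collected. *)
Lemma precedes_rotate A B D :
    precedes A B -> precedes A D -> precedes B D ->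
  precedes (t * A + u * (B + D)) (t * (A + B) + u * D).
Proof.
move=> [AB BA] [AD DA] [BD DB]; have tu0 := ltW tu_gt0.
have t0 : 0 <= t * t^* by exact: mul_conjC_ge0.
have u0 : 0 <= u * u^* by exact: mul_conjC_ge0.
split.
  apply: (@Im_ge0_rewrite ((t * t^*) * (B * A^*) + t * u^* * (A * B^*)
     + (B * B^*) * (t * u^*) + t * u^* * (B * D^*) + u * u^* * (D * B^*)
     + (t * t^* * (A * A^*) + u * u^* * (D * D^*))
     + (t * A * u^* * D^* + (t * A * u^* * D^*)^*))).
    by rewrite !(rmorphM, rmorphD) /= !conjCK; ring.
  apply: Im_ge0_add; last by rewrite Im_real_sum.
  do !apply: Im_ge0_add => //; try by apply: Im_ge0_scale => //; exact: mul_conjC_ge0.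
    by rewrite (Creal_ImP _ _) // ger0_real // mulr_ge0 ?mul_conjC_ge0.
  by rewrite (Creal_ImP _ _) // ger0_real // mulr_ge0 ?mul_conjC_ge0.
apply: (@Im_ge0_rewrite (((t * A + u * D) * (t * A + u * D)^*) * (t * u^*)
     + (t * t^*) * (t * u^* * (A * B^*)) + (t * t^*) * ((u * u^*) * (B * A^*))
     + (u * u^*) * (t * u^* * (B * D^*)) + (t * t^*) * ((u * u^*) * (D * B^*))
     + ((t * t^*) * (u * u^*)) * (B * B^*))).
  by rewrite !(rmorphM, rmorphD) /=; ring.
do !apply: Im_ge0_add; first by apply: Im_ge0_scale => //; exact: mul_conjC_ge0.
- exact: Im_ge0_scale.
- by apply: Im_ge0_scale => //; exact: Im_ge0_scale.
- exact: Im_ge0_scale.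
- by apply: Im_ge0_scale => //; exact: Im_ge0_scale.
rewrite (Creal_ImP _ _) // ger0_real //.
by rewrite mulr_ge0 ?mul_conjC_ge0 // mulr_ge0.
Qed.

(** A sector of opening less than pi contains no two opposite rays. *)
Lemma precedes_opp v : precedes v (- v) -> v = 0.
Proof.
move=> [_]; rewrite rmorphN /= mulrN mulrN raddfN /= mulrC oppr_ge0.
rewrite ImMl ?ger0_real ?mul_conjC_ge0 // pmulr_lle0 // => vv.
by apply/eqP; rewrite -mul_conjC_eq0 eq_le vv mul_conjC_ge0.
Qed.

Lemma precedes_sum_nat m v a b c d :
    spread m v -> (b <= c)%N -> (d <= m)%N ->
  precedes (\sum_(a <= i < b) v i) (\sum_(c <= j < d) v j).
Proof.
move=> vP bc dm; rewrite [X in precedes X]big_nat [X in precedes _ X]big_nat.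
by apply: precedes_sum => i j /andP[_ ib] /andP[cj jd]; apply: vP; lia.
Qed.

Lemma spread_scale m v a :
    (forall j, (j < m)%N -> 0 <= a j) -> spread m v ->
  spread m (fun j => a j * v j).
Proof.
by move=> a0 vP i j ij; apply: precedes_scale; [apply: a0|apply: a0|apply: vP]; lia.
Qed.

Lemma spread_tail m v :
  spread m v -> spread m.+1 (fun k => \sum_(k <= i < m) v i).
Proof.
move=> vP i j /andP[ij jm]; rewrite (@big_cat_nat _ _ _ j i m) //=.
by apply: precedes_drop; apply: (precedes_sum_nat _ vP).
Qed.

Lemma spread_rotate m v : spread m v ->
  spread m.+1
    (fun k => t * \sum_(0 <= i < k) v i + u * \sum_(k <= i < m) v i).
Proof.
move=> vP i j /andP[ij jm].
rewrite (@big_cat_nat _ _ _ j i m) //= (@big_cat_nat _ _ _ i 0 j) //=.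
by apply: precedes_rotate; apply: (precedes_sum_nat _ vP) => //; lia.
Qed.

(** If the sum vanished, its tail would be the opposite of its first term, although
the first term precedes the tail. *)
Lemma spread_sum_neq0 m v (a : nat -> C) :
    spread m.+1 v -> (forall j, (j <= m)%N -> 0 <= a j) ->
    0 < a 0 -> v 0 != 0 ->
  \sum_(0 <= j < m.+1) a j * v j != 0.
Proof.
move=> vP a0 a00 v0; rewrite big_ltn //; apply/eqP => /eqP.
rewrite addrC addr_eq0 => /eqP E.
have := precedes_sum_nat 0 (@spread_scale m.+1 v a a0 vP) (leqnn 1) (leqnn _).
rewrite E big_nat1 => /precedes_opp/eqP.
by rewrite mulf_eq0 (negPf v0) (gt_eqF a00).
Qed.

(** Let P and M be the combinations with coefficients a and c. Because c_j / a_j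
decreases, M gives more weight to the first vectors than P does, so that
Im (P * conj M) >= 0. If u P + t M = 0, then P = - (t / u) M, for which this
imaginary part is - Im (t / u) |M|^2, so that M and then P vanish, which
spread_sum_neq0 excludes. *)
Lemma spread_mix_neq0 m v (a c : nat -> C) :
    spread m.+1 v -> (forall j, (j <= m)%N -> 0 <= a j) ->
    0 < a 0 -> v 0 != 0 -> (forall j, (j <= m)%N -> 0 <= c j) ->
    (forall i j, (i < j <= m)%N -> a i * c j <= a j * c i) ->
  \sum_(0 <= j < m.+1) (a j * u + c j * t) * v j != 0.
Proof.
move=> vP a0 a00 v0 c0 ac.
set P := \sum_(0 <= j < m.+1) a j * v j.
set M := \sum_(0 <= j < m.+1) c j * v j.
have -> : \sum_(0 <= j < m.+1) (a j * u + c j * t) * v j = u * P + t * M.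
  by rewrite !mulr_sumr -big_split /=; apply: eq_bigr => j _; ring.
have PM : 0 <= 'Im (P * M^*).
  have acC j : (j < m.+1)%N -> (c j)^* = c j by move=> jm; rewrite geC0_conj ?c0.
  have E : 'Im (P * M^*) = \sum_(i < m.+1) \sum_(j < m.+1)
      a j * c i * 'Im (v j * (v i)^*).
    rewrite /P /M !big_mkord exchange_big /= mulr_suml raddf_sum.
    apply: eq_bigr => j _; rewrite rmorph_sum mulr_sumr raddf_sum.
    apply: eq_bigr => i _; rewrite rmorphM /= acC // -ImMl; last first.
      by rewrite ger0_real // mulr_ge0 ?a0 ?c0 // -ltnS.
    by congr ('Im _); ring.
  (* Im (P * conj M) is symmetrised in i and j. *)
  have E' := E; rewrite exchange_big /= in E'.
  rewrite -(pmulr_rge0 _ (ltr0n C 2)) mulr_natl mulr2n {1}E' E.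
  rewrite -big_split sumr_ge0 //= => i _; rewrite -big_split sumr_ge0 //= => j _.
  have -> : 'Im (v i * (v j)^*) = - 'Im (v j * (v i)^*).
    by rewrite -Im_conj rmorphM /= conjCK mulrC.
  rewrite mulrN addrC -mulrBl.
  have [ij|ji|->] := ltngtP (val i) (val j); last by rewrite subrr mul0r.
    rewrite mulr_ge0 //; last by case: (vP i j _) => //; rewrite ltnW /=.
    by rewrite subr_ge0 ac // ij -ltnS /=.
  rewrite mulr_le0 //.
    by rewrite subr_le0 ac // ji -ltnS /=.
  have [+ _] : precedes (v j) (v i) by apply: vP; rewrite ltnW /=.
  by rewrite -[v i * _]conjCK Im_conj oppr_ge0 rmorphM /= conjCK mulrC.
have u0 : u != 0.
  by apply/eqP => u0; have := tu_gt0; rewrite u0 rmorph0 mulr0 raddf0 ltxx.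
apply/eqP => /eqP; rewrite addr_eq0 => /eqP uP.
have : 0 <= 'Im (u * u^* * (P * M^*)) by rewrite Im_ge0_scale // mul_conjC_ge0.
have -> : u * u^* * (P * M^*) = - (M * M^* * (t * u^*)).
  by transitivity (u * P * (u^* * M^*)); [ring|rewrite uP; ring].
rewrite raddfN /= oppr_ge0 ImMl ?ger0_real ?mul_conjC_ge0 // pmulr_lle0 // => MM.
have M0 : M = 0 by apply/eqP; rewrite -mul_conjC_eq0 eq_le MM mul_conjC_ge0.
move/eqP: uP; rewrite M0 mulr0 oppr0 mulf_eq0 (negPf u0) /=; apply/negP.
exact: spread_sum_neq0.
Qed.

End Sector.

(** * Newton's backward interpolation formula *)

Section Newton.

Variables (F : fieldType) (f : nat -> F) (S : pred nat) (t : F).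

Definition newton (k : nat) (y : F) : F :=
  \prod_(i < k) ((y - f i) / (f k - f i)).

(** The coefficients of Newton's backward interpolation formula at the nodes
f n, f n.-1, ..., for divided differences normalised so as to give the value 1
to the Newton basis polynomial of index n. *)
Definition backward (n j : nat) (y : F) : F :=
  \prod_(i < j) ((y - f (n - i)%N) / (f n - f (n - i.+1)%N)).

(** In the application to chains, layer n n is the weighted number of chains that
end at a given flat of rank n (for n = 0, the number 1); layer n j is the
normalised divided difference over f (n - j), ..., f n of the polynomial
sum_k newton k y * layer k k. *)
Fixpoint layer (n : nat) : nat -> F :=
  if n is n'.+1 then fun k =>
    (if S n then t else 0)
        * \sum_(0 <= j < n) backward n' j (f n) * layer n' j
    + \sum_(k <= j < n) backward n' j (f n) * layer n' j
  else fun=> 1.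

Lemma layerS n k : layer n.+1 k = layer n.+1 n.+1
  + \sum_(k <= j < n.+1) backward n j (f n.+1) * layer n j.
Proof. by rewrite /= [X in _ = _ + X + _]big_geq // addr0. Qed.

(** The partial sums telescope: the ratio of the term of index l + 1 to the partial
sum up to l is (y - f n) / (f n - f (n - l - 1)). *)
Lemma backward_partial_sum n l y :
    (forall i, (i < n)%N -> f n != f i) -> (l <= n)%N ->
  \sum_(0 <= j < l.+1) backward n j y
    = \prod_(i < l) ((y - f (n - i.+1)%N) / (f n - f (n - i.+1)%N)).
Proof.
move=> fn; elim: l => [|l IHl] ln.
  by rewrite big_nat1 /backward !big_ord0.
rewrite big_nat_recr //= IHl ?(ltnW ln) // /backward !prodf_div.
set P := \prod_(i < l) (y - _).
have -> : \prod_(i < l.+1) (y - f (n - i)%N) = (y - f n) * P.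
  by rewrite big_ord_recl subn0.
rewrite !big_ord_recr /= -/P; set Q := \prod_(i < l) _.
have Q0 : Q != 0.
  by apply/prodf_neq0 => i _; rewrite subr_eq0 fn //; lia.
have l0 : f n - f (n - l.+1)%N != 0 by rewrite subr_eq0 fn //; lia.
by field; rewrite Q0 l0.
Qed.

Lemma newtonE n y : newton n y
  = \prod_(i < n) ((y - f (n - i.+1)%N) / (f n - f (n - i.+1)%N)).
Proof. by rewrite /newton (reindex_inj rev_ord_inj). Qed.

Lemma backward_shift n l y :
    (forall i, (i < n.+1)%N -> f n.+1 != f i) -> (l <= n)%N ->
  \prod_(i < l) ((y - f (n.+1 - i.+1)%N) / (f n.+1 - f (n.+1 - i.+1)%N))
    * backward n l (f n.+1) = backward n l y.
Proof.
move=> fn ln; rewrite -big_split; apply: eq_bigr => i _ /=.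
rewrite subSS mulf_div [X in _ / X]mulrC -mulf_div divff ?mulr1 //.
by rewrite subr_eq0 fn // ltnS leq_subr.
Qed.

Lemma exchange_sum_triangle n (X : nat -> nat -> F) :
  \sum_(0 <= j < n.+1) \sum_(j <= l < n) X j l
    = \sum_(0 <= l < n) \sum_(0 <= j < l.+1) X j l.
Proof.
rewrite big_nat_recr //= [X in _ + X]big_geq // addr0.
under eq_bigr do rewrite (big_nat_widenl _ 0) //.
rewrite (exchange_big_dep_nat xpredT) //=; apply: eq_big_nat => l /andP[_ ln].
by rewrite [RHS](big_nat_widen _ _ n) //.
Qed.

(** Newton's backward interpolation formula. In the step from n to n + 1 both sides
are expanded in the layers of index n; comparing coefficients leaves the two
product formulas backward_partial_sum and backward_shift. *)
Lemma newton_layer n y :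
    (forall i j, (i < j <= n)%N -> f j != f i) ->
  \sum_(0 <= k < n.+1) newton k y * layer k k
    = \sum_(0 <= j < n.+1) backward n j y * layer n j.
Proof.
elim: n => [|n IHn] fn; first by rewrite !big_nat1 /newton /backward !big_ord0.
rewrite big_nat_recr // IHn => [|i j ij]; last by apply: fn; lia.
under [in RHS]eq_bigr do rewrite layerS mulrDr.
rewrite big_split -mulr_suml backward_partial_sum //; last first.
  by move=> i ni; apply: fn; lia.
rewrite -newtonE [LHS]addrC; congr (_ + _).
under [in RHS]eq_bigr do rewrite mulr_sumr.
rewrite exchange_sum_triangle; apply: eq_big_nat => l /andP[_ ln].
rewrite -mulr_suml backward_partial_sum //=; last exact: ltnW.
rewrite mulrA backward_shift // => i ni; apply: fn; lia.
by move=> i ni; apply: fn; lia.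
Qed.

Lemma layer_diag n :
    (forall i j, (i < j <= n)%N -> f j != f i) ->
  layer n.+1 n.+1 = (if S n.+1 then t else 0)
    * \sum_(0 <= k < n.+1) newton k (f n.+1) * layer k k.
Proof. by move=> fn; rewrite newton_layer //= [X in _ + X]big_geq // addr0. Qed.

End Newton.

(** * Nonvanishing of the layers *)

Section Increasing.

Variables (F : numFieldType) (f : nat -> F) (N : nat).
Hypothesis f_lt : forall i j, (i < j <= N)%N -> f i < f j.

Lemma node_le i j : (i <= j <= N)%N -> f i <= f j.
Proof.
case/andP; rewrite leq_eqVlt => /predU1P[->//|ij] jN.
by rewrite ltW // f_lt // ij.
Qed.

Lemma node_neq i j : (i < j <= N)%N -> f j != f i.
Proof. by move=> ij; rewrite gt_eqF // f_lt. Qed.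

Lemma backward_ge0 n j m :
  (j <= n <= m)%N -> (m <= N)%N -> 0 <= backward f n j (f m).
Proof.
move=> jnm mN; apply: prodr_ge0 => i _; have := ltn_ord i => ij.
by rewrite mulr_ge0 ?invr_ge0 // subr_ge0 node_le //; lia.
Qed.

Lemma backward_gt0 n j m :
  (j <= n < m)%N -> (m <= N)%N -> 0 < backward f n j (f m).
Proof.
move=> jnm mN; apply: prodr_gt0 => i _; have := ltn_ord i => ij.
by rewrite mulr_gt0 ?invr_gt0 // subr_gt0 f_lt //; lia.
Qed.

(** The quotient of backward n j by backward n i is a product of the increasing
factors (y - f k) / const with k <= n, nonnegative for y >= f n. *)
Lemma backward_ratio n i j m m' :
    (i <= j <= n)%N -> (n <= m <= m')%N -> (m' <= N)%N ->
  backward f n i (f m') * backward f n j (f m)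
    <= backward f n j (f m') * backward f n i (f m).
Proof.
move=> /andP[ij jn] nm m'N.
have [k jE] : exists k, j = (i + k)%N by exists (j - i)%N; rewrite subnKC.
pose Q y := \prod_(l < k)
  ((y - f (n - (i + l))%N) / (f n - f (n - (i + l).+1)%N)).
have split_j y : backward f n j y = backward f n i y * Q y.
  by rewrite {1}/backward jE big_split_ord.
rewrite !split_j mulrA [leRHS]mulrAC.
rewrite ler_wpM2l ?mulr_ge0 ?backward_ge0 //; try lia.
apply: ler_prod => l _; have := ltn_ord l => lk; apply/andP; split.
  by rewrite mulr_ge0 ?invr_ge0 // subr_ge0 node_le //; lia.
rewrite ler_wpM2r ?invr_ge0 ?subr_ge0 ?lerD2r ?node_le //; lia.
Qed.

End Increasing.

Section Nonvanishing.

Variables (C : numClosedFieldType) (f : nat -> C) (S : pred nat) (t : C).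
Variable N : nat.
Hypothesis f_lt : forall i j, (i < j <= N)%N -> f i < f j.

Local Notation layer := (layer f S t).

Lemma half_plane_sector : 0 < 'Im t -> 0 < 'Im (t * (1 + t)^*).
Proof.
rewrite rmorphD rmorph1 mulrDr mulr1 raddfD /=.
by rewrite (Creal_ImP (t * t^*) _) ?addr0 // ger0_real // mul_conjC_ge0.
Qed.

Lemma layer_spread n : 0 < 'Im t -> (n <= N)%N ->
  spread t (1 + t) n.+1 (layer n) /\ layer n 0 != 0.
Proof.
move=> t0; have tu := half_plane_sector t0.
elim: n => [_|n IHn nN].
  split; last exact: oner_neq0.
  by move=> i j ij; exact: precedes_refl.
have [lP l0] := IHn (ltnW nN).
have wP : spread t (1 + t) n.+1 (fun j => backward f n j (f n.+1) * layer n j).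
  by apply: spread_scale => // j jn; apply: (backward_ge0 f_lt); lia.
have w0 : \sum_(0 <= j < n.+1) backward f n j (f n.+1) * layer n j != 0.
  apply: (spread_sum_neq0 tu lP) => // [j jn|].
    by apply: (backward_ge0 f_lt); lia.
  by apply: (backward_gt0 f_lt); lia.
have t1 : 1 + t != 0.
  by apply/eqP => t1; move: tu; rewrite t1 rmorph0 mulr0 raddf0 ltxx.
rewrite /=; case: (S n.+1); last first.
  split; last by rewrite mul0r add0r.
  by move=> i j ij; rewrite !mul0r !add0r; apply: (spread_tail tu wP).
split; last first.
  rewrite (_ : _ + _ = (1 + t)
      * \sum_(0 <= j < n.+1) backward f n j (f n.+1) * layer n j).
    by rewrite mulf_neq0.
  by rewrite mulrDl mul1r addrC.
have E k : (k <= n.+1)%N -> let w j := backward f n j (f n.+1) * layer n j in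
    t * \sum_(0 <= j < n.+1) w j + \sum_(k <= j < n.+1) w j =
    t * \sum_(0 <= i < k) w i + (1 + t) * \sum_(k <= i < n.+1) w i.
  move=> kn w; rewrite (@big_cat_nat _ _ _ k 0 n.+1) //=; ring.
move=> i j ij; rewrite !E; try lia.
exact: (spread_rotate tu wP).
Qed.

(** The number of factors t or 1 + t that the recursion has collected up to layer n;
for t < -1 it fixes the common sign of that layer. *)
Definition weight n : nat := \sum_(0 <= i < n) S i.+1.

(** Multiplying by t to the power weight n turns the factors t and 1 + t of each
selected step into the nonnegative numbers t * t and t * (1 + t). *)
Lemma layer_pos n : t \is Num.real -> 0 < t * (1 + t) -> (n <= N)%N ->
  (forall j, (j <= n)%N -> 0 <= t ^+ weight n * layer n j)
  /\ 0 < t ^+ weight n * layer n 0.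
Proof.
move=> tR tu; elim: n => [_|n IHn nN].
  by rewrite /weight big_geq // mul1r ltr01; split=> // j _; rewrite ler01.
have [lP l0] := IHn (ltnW nN).
have wP j : (j <= n)%N -> 
    0 <= t ^+ weight n * (backward f n j (f n.+1) * layer n j).
  move=> jn; rewrite mulrCA mulr_ge0 ?lP // (backward_ge0 f_lt) //; lia.
have w0 : 0 < t ^+ weight n * (backward f n 0 (f n.+1) * layer n 0).
  rewrite mulrCA mulr_gt0 // (backward_gt0 f_lt) //; lia.
have tailP k : 0 <= t ^+ weight n *
    \sum_(k <= j < n.+1) backward f n j (f n.+1) * layer n j.
  by rewrite mulr_sumr big_nat_cond sumr_ge0 // => j /andP[/andP[_ jn] _]; exact: wP.
have sum0 : 0 < t ^+ weight n *
    \sum_(0 <= j < n.+1) backward f n j (f n.+1) * layer n j.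
  rewrite big_ltn // mulrDr ltr_wpDr //; exact: tailP.
have -> : weight n.+1 = (weight n + S n.+1)%N by rewrite /weight big_nat_recr.
rewrite /=; case: (S n.+1) => /=; last first.
  rewrite addn0; split=> [j _|]; rewrite mul0r add0r //.
have t2 : 0 <= t * t by rewrite -expr2 real_exprn_even_ge0.
rewrite addn1 exprS; split=> [j jn|].
  rewrite (@big_cat_nat _ _ _ j 0 n.+1) //=.
  set A := (X in t * (X + _)); set B := (X in t * (_ + X)).
  have -> : t * t ^+ weight n * (t * (A + B) + B) =
    (t * t) * (t ^+ weight n * A) + (t * (1 + t)) * (t ^+ weight n * B) by ring.
  rewrite addr_ge0 // mulr_ge0 //; [|exact: ltW|exact: tailP].
  rewrite mulr_sumr big_nat_cond sumr_ge0 // => i /andP[/andP[_ ij] _].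
  apply: wP; lia.
set A := (X in (t * X + _)).
have -> : t * t ^+ weight n * (t * A + A) = (t * (1 + t)) * (t ^+ weight n * A).
  by ring.
exact: mulr_gt0.
Qed.

(** For a real polynomial with no admissible zero all zeros are in [-1, 0]: the
lower half-plane follows by conjugation, and a real t is outside [-1, 0] exactly
if t * (1 + t) > 0. *)
Definition admissible := 0 < 'Im t \/ t \is Num.real /\ 0 < t * (1 + t).

Lemma layer_mix_neq0 n (a c : nat -> C) : admissible -> (n <= N)%N ->
    (forall j, (j <= n)%N -> 0 <= a j) ->
    0 < a 0 -> (forall j, (j <= n)%N -> 0 <= c j) ->
    (forall i j, (i < j <= n)%N -> a i * c j <= a j * c i) ->
  \sum_(0 <= j < n.+1) (a j * (1 + t) + c j * t) * layer n j != 0.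
Proof.
move=> [t0|[tR tu]] nN a0 a00 c0 ac.
  have tu := half_plane_sector t0.
  have [lP l0] := layer_spread t0 nN.
  exact: (spread_mix_neq0 tu).
have [lP l0] := layer_pos tR tu nN.
have t2 : 0 <= t * t by rewrite -expr2 real_exprn_even_ge0.
suff : 0 < (t * t ^+ weight n) *
  \sum_(0 <= j < n.+1) (a j * (1 + t) + c j * t) * layer n j.
  by apply: contraL => /eqP ->; rewrite mulr0 ltxx.
have E j : t * t ^+ weight n * ((a j * (1 + t) + c j * t) * layer n j) =
   (a j * (t * (1 + t)) + c j * (t * t)) * (t ^+ weight n * layer n j) by ring.
rewrite mulr_sumr; under eq_bigr do rewrite E.
rewrite big_ltn // ltr_wpDr //.
  rewrite big_nat_cond sumr_ge0 // => j /andP[/andP[_ jn] _].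
  by rewrite mulr_ge0 ?lP // addr_ge0 // mulr_ge0 ?a0 ?c0 // ltW.
 apply: mulr_gt0 => //; apply: ltr_wpDr; last exact: mulr_gt0.
by apply: mulr_ge0 => //; exact: c0.
Qed.

Lemma layer_sum_neq0 n (a : nat -> C) : admissible -> (n <= N)%N ->
    (forall j, (j <= n)%N -> 0 <= a j) -> 0 < a 0 ->
  \sum_(0 <= j < n.+1) a j * layer n j != 0.
Proof.
move=> [t0|[tR tu]] nN a0 a00.
  have tu := half_plane_sector t0.
  have [lP l0] := layer_spread t0 nN.
  exact: (spread_sum_neq0 tu).
have [lP l0] := layer_pos tR tu nN.
suff : 0 < t ^+ weight n * \sum_(0 <= j < n.+1) a j * layer n j.
  by apply: contraL => /eqP ->; rewrite mulr0 ltxx.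
rewrite mulr_sumr; under eq_bigr do rewrite mulrCA.
rewrite big_ltn // ltr_wpDr //; last exact: mulr_gt0.
rewrite big_nat_cond sumr_ge0 // => j /andP[/andP[_ jn] _].
by rewrite mulr_ge0 ?a0 ?lP.
Qed.

(** Here m h is the rank of the block h. The equation on newton f n.+1 says that the
blocks partition the flats of rank n.+1. *)
Lemma paving_sum_neq0 (I : finType) (P : pred I) (m : I -> nat) n :
    admissible -> (n < N)%N -> f 0 = 0 ->
    (forall h, P h -> (n < m h <= N)%N) ->
    \sum_(h | P h) newton f n.+1 (f (m h)) = newton f n.+1 (f N) ->
  \sum_(0 <= k < n.+1) newton f k (f N) * layer k k
    + (if S n.+1 then t else 0)
      * \sum_(h | P h) \sum_(0 <= k < n.+1) newton f k (f (m h)) * layer k k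
    != 0.
Proof.
move=> tP nN f0 mN mP.
have fn i j : (i < j <= n)%N -> f j != f i.
  by move=> ij; apply: (node_neq f_lt); lia.
under [X in _ + _ * X]eq_bigr do rewrite newton_layer //.
rewrite newton_layer // exchange_big /=.
under [X in _ + _ * X]eq_bigr do rewrite -mulr_suml.
pose a j := backward f n j (f N).
pose W j := \sum_(h | P h) backward f n j (f (m h)).
have a0 j : (j <= n)%N -> 0 < a j.
  by move=> jn; apply: (backward_gt0 f_lt) => //; rewrite jn.
case: (S n.+1); last first.
  rewrite mul0r addr0; apply: layer_sum_neq0 => //; first exact: ltnW.
    by move=> j jn; rewrite ltW // a0.
  exact: a0.
have ratio i j : (i <= j <= n)%N -> a i * W j <= a j * W i.
  move=> ij; rewrite !mulr_sumr; apply: ler_sum => h Ph.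
  by apply: (backward_ratio f_lt) => //; move: (mN h Ph); lia.
(* As f 0 = 0, the basis polynomial of index n.+1 is y * backward f n n y up to a
   constant, and the factor f (m h) is at most f N. *)
have Wn : a n <= W n.
  have nE y : newton f n.+1 y = 
      y * backward f n n y * ((\prod_(i < n) (f n - f (n - i.+1)%N)) /
       \prod_(i < n.+1) (f n.+1 - f i)).
    rewrite /newton /backward !prodf_div.
    have -> : \prod_(i < n.+1) (y - f i) = y * \prod_(i < n) (y - f (n - i)%N).
      rewrite big_ord_recl f0 subr0 (reindex_inj rev_ord_inj) /=.
      by congr (_ * _); apply: eq_bigr => i _; rewrite /bump add1n subnSK.
    set Q := \prod_(i < n) (f n - _); have Q0 : Q != 0.
      apply/prodf_neq0 => i _; rewrite subr_eq0 fn //.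
      by have := ltn_ord i; lia.
    by rewrite -!mulrA (mulrA _ Q) mulVf // mul1r.
  move: mP; rewrite nE; under eq_bigr do rewrite nE.
  rewrite -mulr_suml => /mulIf => mP.
  have {}mP : \sum_(h | P h) f (m h) * backward f n n (f (m h)) = f N * a n.
    apply: mP; rewrite mulf_neq0 ?invr_neq0 //; apply/prodf_neq0 => i _;
      rewrite subr_eq0 (node_neq f_lt) //; have := ltn_ord i; lia.
  have fN0 : 0 < f N by rewrite -f0 f_lt //; lia.
  rewrite -(ler_pM2l fN0) -mP mulr_sumr; apply: ler_sum => h Ph.
  have := mN h Ph => mh; rewrite ler_wpM2r //.
    by apply: (backward_ge0 f_lt); lia.
  by apply: (node_le f_lt); lia.
have Wa j : (j <= n)%N -> a j <= W j.
  move=> jn; rewrite -(ler_pM2l (a0 n _)) //.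
  apply: le_trans (ratio j n _); last by rewrite jn /=.
  by rewrite mulrC ler_pM2l // a0.
rewrite mulr_sumr -big_split /=.
have E j : backward f n j (f N) * layer n j + t * (W j * layer n j)
    = (a j * (1 + t) + (W j - a j) * t) * layer n j by rewrite -/(a j); ring.
under eq_bigr do rewrite E.
apply: layer_mix_neq0 => //; try exact: ltnW.
- by move=> j jn; rewrite ltW // a0.
- exact: a0.
- by move=> j jn; rewrite subr_ge0 Wa.
move=> i j ij; rewrite !mulrBr [X in _ <= _ - X]mulrC lerD2r ratio //; lia.
Qed.

End Nonvanishing.

(** * Chain sums of finite posets *)

Section ChainSum.

Variables (disp : Order.disp_t) (T : finPOrderType disp).
Variables (F : comNzRingType) (t : F).
Implicit Types (A B D : {set T}) (x y : T).

(** The value at t of the chain polynomial, in any ring. *)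
Definition chain_sum A : F :=
  \sum_(D : {set T} | (D \subset A) && chain D) t ^+ #|D|.

Lemma chainP D : reflect {in D &, forall x y, (x >=< y)%O} (chain D).
Proof.
apply: (iffP forall_inP) => [h x y xD yD|h x xD].
  by move/forall_inP: (h x xD); apply.
by apply/forall_inP => y yD; apply: h.
Qed.

(** Removing x is a bijection from the chains through x to the chains of elements
comparable to x. *)
Lemma chain_sumD1 A x : x \in A ->
  chain_sum A = chain_sum (A :\ x)
    + t * chain_sum [set y in A | (y != x) && (y >=< x)%O].
Proof.
move=> xA; rewrite /chain_sum (bigID (fun D : {set T} => x \in D)) /= addrC.
congr (_ + _).
  apply: eq_bigl => D; rewrite subsetD1; do !case: (_ \subset _) => //=.
  by rewrite andbC.
rewrite mulr_sumr (reindex_onto (fun D => x |: D) (fun D => D :\ x)) /=.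
  apply: eq_big => [D|D].
    have [xD|xD] := boolP (x \in D).
      rewrite [X in _ && X](_ : _ = false) ?andbF; last first.
        by apply/eqP => /setP/(_ x); rewrite !inE eqxx xD.
      apply/esym/negbTE/negP => /andP[/subsetP/(_ x xD)].
      by rewrite !inE eqxx andbF.
    rewrite setU1K // eqxx andbT setU11 andbT subUset sub1set xA /=.
    apply/andP/andP=> [[/subsetP DA /chainP Dc]|[/subsetP DA /chainP Dc]].
      split; last first.
        by apply/chainP => y z yD zD; apply: Dc; rewrite !inE ?yD ?zD orbT.
      apply/subsetP => y yD; rewrite inE DA //= Dc ?setU11 ?inE ?yD ?orbT //.
      by rewrite andbT; apply: contraNneq xD => <-.
    split; first by apply/subsetP => y /DA; rewrite inE => /and3P[].
    apply/chainP => y z; rewrite !inE => /predU1P[->|yD] /predU1P[->|zD].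
    - exact: comparablexx.
    - by rewrite comparable_sym; have := DA z zD; rewrite inE => /and3P[].
    - by have := DA y yD; rewrite inE => /and3P[].
    - exact: Dc.
  move=> /andP[_ /eqP DE]; rewrite cardsU1 -exprS; congr (_ ^+ _).
  by rewrite -DE !inE eqxx.
by move=> D /andP[_ xD]; rewrite setD1K.
Qed.

Lemma chain_sum_cone A x : x \in A -> {in A, forall y, (y >=< x)%O} ->
  chain_sum A = (1 + t) * chain_sum (A :\ x).
Proof.
move=> xA xP; rewrite (chain_sumD1 xA) mulrDl mul1r; congr (_ + t * chain_sum _).
apply/setP => y; rewrite !inE andbC -andbA; case: eqP => //= _.
by apply: andb_idl; apply: xP.
Qed.

(** Nonempty chains are classified by their largest element. By induction: removing
a maximal x from A leaves the terms of the other elements unchanged. *)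
Lemma chain_sum_max A :
  chain_sum A = 1 + \sum_(x in A) t * chain_sum [set y in A | (y < x)%O].
Proof.
have [n] := ubnP #|A|; elim: n A => // n IHn A; rewrite ltnS => An.
have [->|[x0 x0A]] := set_0Vmem A.
  rewrite big_set0 addr0 /chain_sum (big_pred1 set0) ?cards0 // => D /=.
  rewrite subset0; case: eqP => //= ->; apply/chainP => x y; by rewrite inE.
have [x xA xmax] : exists2 x, x \in A & {in A, forall y, ~~ (x < y)%O}.
  (* An element with the most elements below it is maximal. *)
  pose h x := #|[set y in A | (y < x)%O]|.
  case: (arg_maxnP h x0A) => x xA hx; exists x => // y yA; apply/negP => xy.
  have := hx y yA; rewrite /= leqNgt => /negP; apply; apply: proper_card.
  apply/properP; split; last by exists x; rewrite inE ?xy ?ltxx andbC.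
  by apply/subsetP => z; rewrite !inE => /andP[-> /lt_trans->].
rewrite (chain_sumD1 xA) IHn; last by rewrite [#|A|](cardsD1 x) xA in An.
rewrite [in RHS](big_setD1 x) //= [in RHS]addrCA [RHS]addrC; congr (_ + _ + _).
  apply: eq_bigr => y; rewrite !inE => /andP[_ yA]; congr (t * chain_sum _).
  apply/setP => z; rewrite !inE; have [->|//] := eqVneq z x.
  by rewrite (negPf (xmax y yA)) !andbF.
congr (t * chain_sum _); apply/setP => y; rewrite !inE.
have [yA|//] /= := boolP (y \in A); rewrite /Order.comparable.
rewrite lt_neqAle; case: (eqVneq y x) => //= yx; apply: orb_idr => xy.
by have := xmax y yA; rewrite lt_neqAle xy eq_sym yx.
Qed.

End ChainSum.

Lemma horner_chain_poly disp (T : finPOrderType disp) (K F : comNzRingType)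
    (phi : {rmorphism K -> F}) (A : {set T}) (z : F) :
  (map_poly phi (chain_poly K A)).[z] = chain_sum z A.
Proof.
rewrite /chain_poly poly_def rmorph_sum horner_sum /chain_sum.
rewrite (partition_big (fun D : {set T} => inord #|D| : 'I_#|A|.+1) xpredT) //=.
apply: eq_bigr => k _; rewrite map_polyZ map_polyXn hornerZ hornerXn rmorph_nat.
have cardE (D : {set T}) : D \subset A -> (inord #|D| == k) = (#|D| == k).
  by move=> DA; rewrite -val_eqE /= inordK // ltnS subset_leq_card.
rewrite /num_chains cardsE -sum1_card natr_sum mulr_suml.
apply: eq_big => [D|D /and3P[_ _ /eqP->]]; last by rewrite mul1r.
by rewrite unfold_in -andbA; have [DA|//] := boolP (D \subset A); rewrite cardE.
Qed.

(** * Flats of rank uniform geometric lattices *)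

Section RankFunction.

Variables (disp : Order.disp_t) (L : finTBLatticeType disp) (rho : L -> nat).
Hypothesis rho_rank : rank_function [set: L] rho.
Implicit Types (x y z a : L).
Local Open Scope order_scope.

Lemma rank_bot : rho \bot = 0%N.
Proof. by case: rho_rank => r0 _; apply: r0; split=> [|z _]; rewrite ?inE ?ltx0. Qed.

Lemma lower_cover x y : x < y -> exists2 z, x <= z < y & rho y = (rho z).+1.
Proof.
move=> xy; pose P z := x <= z < y.
have Px : P x by rewrite /P lexx.
case: (arg_maxnP (fun z => #|[set w | w <= z]|) Px) => z Pz zmax.
exists z => //; case: rho_rank => _; apply; split; rewrite ?inE //.
  by case/andP: Pz.
move=> w _; apply/negP => /andP[zw wy].
have /zmax /= : P w by rewrite /P wy andbT (le_trans _ (ltW zw)) //; case/andP: Pz.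
rewrite leqNgt => /negP; apply; apply: proper_card; apply/properP; split.
  by apply/subsetP => v; rewrite !inE => /le_trans; apply; apply: ltW.
by exists w; rewrite inE ?lexx // lt_geF.
Qed.

Lemma rank_lt x y : x < y -> (rho x < rho y)%N.
Proof.
have [n] := ubnP (rho y); elim: n y => // n IHn y yn xy.
have [z /andP[xz zy] E] := lower_cover xy; move: xz; rewrite le_eqVlt E.
by move=> /predU1P[->|xz]; rewrite // ltnS ltnW // IHn // -ltnS -E.
Qed.

Lemma rank_le x y : x <= y -> (rho x <= rho y)%N.
Proof. by rewrite le_eqVlt => /predU1P[->//|/rank_lt/ltnW]. Qed.

Lemma le_rank_eq x y : x <= y -> rho x = rho y -> x = y.
Proof.
by rewrite le_eqVlt => /predU1P[//|/rank_lt xy E]; rewrite E ltnn in xy.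
Qed.

Lemma rank_eq0 x : rho x = 0%N -> x = \bot.
Proof. by move=> x0; apply/esym/le_rank_eq; rewrite ?le0x // rank_bot. Qed.

Lemma rank_between x y k : x <= y -> (rho x <= k <= rho y)%N ->
  exists2 z, x <= z <= y & rho z = k.
Proof.
have [n] := ubnP (rho y); elim: n y => // n IHn y yn xy /andP[xk].
rewrite leq_eqVlt => /predU1P[->|ky]; first by exists y; rewrite ?xy /=.
have {}xy : x < y.
  by rewrite lt_neqAle xy andbT; apply: contraTneq ky => <-; rewrite -leqNgt.
have [z /andP[xz zy] E] := lower_cover xy.
have [||w /andP[xw wz] wk] := IHn z _ xz; [by rewrite -ltnS -E|lia|].
by exists w => //; rewrite xw (le_trans wz) // ltW.
Qed.

Definition count_below x k : nat := #|[set z | z <= x & rho z == k]|.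

Lemma count_below0 x : count_below x 0 = 1%N.
Proof.
rewrite /count_below (_ : [set _ | _ & _] = [set \bot]) ?cards1 //.
apply/setP => z; rewrite !inE; apply/andP/eqP => [[_ /eqP/rank_eq0]//|->].
by rewrite le0x rank_bot.
Qed.

Lemma count_below_rank x : count_below x (rho x) = 1%N.
Proof.
rewrite /count_below (_ : [set _ | _ & _] = [set x]) ?cards1 //.
apply/setP => z; rewrite !inE; apply/andP/eqP => [[zx /eqP]|->].
  exact: le_rank_eq.
by rewrite lexx.
Qed.

Lemma count_below_gt x k : (rho x < k)%N -> count_below x k = 0%N.
Proof.
move=> xk; apply/eqP; rewrite cards_eq0; apply/eqP/setP => z; rewrite !inE.
by apply/andP => -[/rank_le zx /eqP zk]; rewrite zk leqNgt xk in zx.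
Qed.

Hypothesis rho_semimodular : semimodular rho.
Hypothesis L_atomistic : atomistic (L := L).

(** A join of atoms that are all below y is itself below y. *)
Lemma atom_split y z : y < z -> exists a, [/\ rho a = 1%N, a <= z & ~~ (a <= y)].
Proof.
move=> yz; have [A [Aatom zE]] := L_atomistic z.
have [/existsP[a /andP[aA ay]]|/existsPn Ay] := boolP [exists a in A, ~~ (a <= y)].
  exists a; split=> //; last by rewrite zE joins_sup.
  by have := rho_rank.2 _ _ (Aatom a aA); rewrite rank_bot.
have : z <= y.
  rewrite zE; apply/joinsP => a aA.
  by have := Ay a; rewrite aA negbK.
by rewrite lt_geF.
Qed.

(** Semimodularity gives the upper bound, since the meet of y and a is below a and
hence of rank 0. *)
Lemma rank_join_atom y a : rho a = 1%N -> ~~ (a <= y) ->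
  rho (y `|` a) = (rho y).+1.
Proof.
move=> a1 ay; apply/eqP; rewrite eqn_leq; apply/andP; split.
  have /rank_lt : y `&` a < a by rewrite lt_neqAle leIr andbT eq_meetr.
  by have := rho_semimodular y a; lia.
by apply: rank_lt; rewrite lt_neqAle leUl andbT eq_sym eq_joinl.
Qed.

Lemma count_atoms_lt y z : y < z -> (count_below y 1 < count_below z 1)%N.
Proof.
move=> yz; have [a [a1 az ay]] := atom_split yz.
apply: proper_card; apply/properP; split; last first.
  by exists a; rewrite inE a1 ?az // (negPf ay).
apply/subsetP => b; rewrite !inE => /andP[/le_trans by_ ->].
by rewrite andbT by_ // ltW.
Qed.

Hypothesis rho_uniform : rank_uniform rho.

(** A representative of each rank; by rank uniformity the choice does not affect
the counts below it. *)
Definition flat n : L := odflt \bot [pick x | rho x == n].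

Definition atoms_below n : nat := count_below (flat n) 1.

Lemma flat_rank n : (n <= rho \top)%N -> rho (flat n) = n.
Proof.
move=> nN; rewrite /flat; case: pickP => [x /eqP//|none].
have [||z _ zn] := @rank_between \bot \top n; rewrite ?le0x ?rank_bot //.
by have := none z; rewrite zn eqxx.
Qed.

Lemma rank_top x : (rho x <= rho \top)%N.
Proof. by apply: rank_le; rewrite lex1. Qed.

Lemma count_below_flat x k : (k <= rho x)%N ->
  count_below x k = count_below (flat (rho x)) k.
Proof. by move=> kx; apply: rho_uniform; rewrite ?flat_rank ?rank_top. Qed.

Lemma count_atoms x : count_below x 1 = atoms_below (rho x).
Proof.
have [x0|x0] := posnP (rho x); last exact: count_below_flat.
by rewrite /atoms_below !count_below_gt ?flat_rank ?x0.
Qed.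

Lemma atoms_below0 : atoms_below 0 = 0%N.
Proof. by rewrite /atoms_below count_below_gt // flat_rank. Qed.

Lemma atoms_below_lt i j :
  (i < j <= rho \top)%N -> (atoms_below i < atoms_below j)%N.
Proof.
move=> /andP[ij jN]; have fj := flat_rank jN.
have [||y /andP[_ yj] yi] := @rank_between \bot (flat j) i.
- exact: le0x.
- by rewrite rank_bot fj leq0n ltnW.
rewrite -yi -{1}fj -!count_atoms; apply: count_atoms_lt.
by rewrite lt_neqAle yj andbT; apply: contraTneq ij => E; rewrite -yi -fj E ltnn.
Qed.

Lemma count_extending_atoms x y : y <= x ->
  #|[set a | [&& rho a == 1%N, a <= x & ~~ (a <= y)]]|
    = (atoms_below (rho x) - atoms_below (rho y))%N.
Proof.
move=> yx; rewrite -!count_atoms /count_below -cardsDS; last first.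
  by apply/subsetP => a; rewrite !inE => /andP[/le_trans ax ->]; rewrite ax.
apply: eq_card => a; rewrite !inE; case: (rho a == 1%N); rewrite ?andbF ?andbT //=.
by rewrite andbC.
Qed.

(** The number of pairs (y, a) of a flat y of rank k and an atom a with a given join
of rank k.+1. *)
Definition extensions k : nat :=
  (count_below (flat k.+1) k * (atoms_below k.+1 - atoms_below k))%N.

(** Both sides count the pairs (y, a) of a flat y of rank k and an atom a not below
y, both below x: by y on the left, by the join of y and a, of rank k.+1, on the
right. Hence the counts satisfy the recursion of the Newton basis. *)
Lemma count_below_step x k : (k < rho x)%N ->
  (count_below x k * (atoms_below (rho x) - atoms_below k)
    = count_below x k.+1 * extensions k)%N.
Proof.
move=> kx.
have pairs z : #|[set p : L * L | [&& p.1 <= z, rho p.1 == k,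
      rho p.2 == 1%N, p.2 <= z & ~~ (p.2 <= p.1)]]|
    = (count_below z k * (atoms_below (rho z) - atoms_below k))%N.
  rewrite -sum1_card (eq_bigl (fun p : L * L => (p.1 <= z) && (rho p.1 == k)
    && [&& rho p.2 == 1%N, p.2 <= z & ~~ (p.2 <= p.1)])); last first.
    by move=> p; rewrite !inE -!andbA.
  rewrite -(pair_big_dep (fun y => (y <= z) && (rho y == k))
    (fun y a => [&& rho a == 1%N, a <= z & ~~ (a <= y)]) (fun _ _ => 1%N)) /=.
  rewrite /count_below -sum_nat_const; apply: eq_big => y; rewrite ?inE //.
  move=> /andP[yz /eqP <-]; rewrite -count_extending_atoms // -sum1_card.
  by apply: eq_bigl => a; rewrite inE.
rewrite -pairs -sum1_card.
rewrite (partition_big (fun p => p.1 `|` p.2)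
    (fun z => (z <= x) && (rho z == k.+1))) /=; last first.
  move=> p; rewrite inE => /and5P[px /eqP pk /eqP p1 ax ap].
  by rewrite leUx px ax rank_join_atom // pk /=.
rewrite /count_below -sum_nat_const; apply: eq_big => z; rewrite ?inE //.
move=> /andP[zx /eqP zk]; rewrite sum1_card /extensions -zk.
rewrite -count_below_flat; last by rewrite zk.
rewrite -pairs; apply: eq_card => p.
rewrite unfold_in !inE; apply/andP/and5P.
  move=> [/and5P[px pk p1 ax ap] /eqP <-]; split=> //; [exact: leUl|exact: leUr].
move=> [pz pk p1 az ap]; split.
  by apply/and5P; split=> //; apply: le_trans zx.
apply/eqP/le_rank_eq; first by rewrite leUx pz az.
by rewrite rank_join_atom ?(eqP p1) // (eqP pk).
Qed.

Variable F : numFieldType.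

Definition atoms_in n : F := (atoms_below n)%:R.

Lemma atoms_in_lt i j :
  (i < j <= rho \top)%N -> (atoms_in i < atoms_in j)%R.
Proof. by move=> ij; rewrite ltr_nat atoms_below_lt. Qed.

(** By count_below_step the count is a constant depending only on k times the product
of the f (rho x) - f i with i < k. The case where x itself has rank k, with
count 1, fixes the constant. *)
Lemma count_below_newton x k : (k <= rho x)%N ->
  (count_below x k)%:R = newton atoms_in k (atoms_in (rho x)) :> F.
Proof.
have [c cP] : exists c : nat -> F, forall x k, (k <= rho x)%N ->
    (count_below x k)%:R
      = (c k * \prod_(i < k) (atoms_in (rho x) - atoms_in i))%R :> F.
  exists (fun k => \prod_(i < k) (extensions i)%:R^-1)%R => {}x {}k.
  elim: k => [_|k IHk kx]; first by rewrite count_below0 !big_ord0 mulr1.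
  have e0 : (extensions k)%:R != 0 :> F.
    rewrite pnatr_eq0 muln_eq0 negb_or -!lt0n subn_gt0 atoms_below_lt; last first.
      by rewrite leqnn (leq_trans kx) // rank_top.
    rewrite andbT; have fk := flat_rank (leq_trans kx (rank_top x)).
    have [||y /andP[_ yf] yk] := @rank_between \bot (flat k.+1) k.
    - exact: le0x.
    - by rewrite rank_bot fk leq0n leqnSn.
    by apply/card_gt0P; exists y; rewrite inE yf yk eqxx.
  apply: (mulIf e0); rewrite -natrM -count_below_step // natrM natrB; last first.
    by rewrite ltnW // atoms_below_lt // kx rank_top.
  rewrite IHk ?(ltnW kx) // !big_ord_recr /= -/(atoms_in _) -/(atoms_in k).
  by field.
move=> kx; rewrite cP // /newton prodf_div mulrC; congr (_ * _)%R.
have fk : rho (flat k) = k by rewrite flat_rank // (leq_trans kx) // rank_top.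
have := cP (flat k) k; rewrite fk => /(_ (leqnn k)).
have := count_below_rank (flat k); rewrite fk => -> /esym E.
have P0 : (\prod_(i < k) (atoms_in k - atoms_in i))%R != 0.
  by apply: contra_eq_neq E => ->; rewrite mulr0 eq_sym oner_neq0.
by apply: (mulIf P0); rewrite E mulVf.
Qed.

End RankFunction.

(** * Chains of paving lattices *)

Section Paving.

Variables (disp : Order.disp_t) (L : finTBLatticeType disp) (rho : L -> nat).
Hypotheses (L_geometric : geometric_lattice rho) (L_uniform : rank_uniform rho).
Variables (n : nat) (H : {set L}).
Hypotheses (n_lt : (n.+1 < rho \top%O)%N) (HP : generalized_partition rho n.+1 H).
Implicit Types (x y z h : L) (S : pred nat).

Let rho_rank : rank_function [set: L] rho. Proof. by case: L_geometric. Qed.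

Definition paving_rank x : nat :=
  if x == \top%O then n.+2 else if x \in H then n.+1 else rho x.

Lemma block_rank h : h \in H -> (n < rho h)%N.
Proof. by case: HP => _ + _ _; apply. Qed.

Lemma block_incomparable h h' : h \in H -> h' \in H -> ~~ (h < h')%O.
Proof.
case: HP => _ _ anti _ hH hH'; apply/negP => hh'.
by have E := anti _ _ hH hH' (ltW hh'); rewrite E ltxx in hh'.
Qed.

Lemma paving_rank_low x : (rho x <= n)%N -> paving_rank x = rho x.
Proof.
move=> xn; rewrite /paving_rank; case: eqP => [E|_].
  by move: xn; rewrite E; lia.
by case: ifP => // /block_rank; lia.
Qed.

Lemma paving_rank_block x : x \in H -> paving_rank x = n.+1.
Proof.
move=> xH; rewrite /paving_rank xH; case: eqP => // E.
by case: HP => + _ _ _; rewrite -E xH.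
Qed.

Lemma in_paving_set x :
  (x \in paving_set rho n.+1 H) = [|| (rho x <= n)%N, x \in H | x == \top%O].
Proof. by rewrite !inE orbA. Qed.

(** Each flat of rank n.+1 is below exactly one block. *)
Lemma count_blocks :
  (\sum_(h in H) count_below rho h n.+1 = count_below rho \top%O n.+1)%N.
Proof.
rewrite /count_below -sum1_card.
under eq_bigr do rewrite -sum1_card.
rewrite (exchange_big_dep (mem [set z | (z <= \top)%O & rho z == n.+1])) /=;
  last first.
  by move=> h x _; rewrite !inE lex1 => /andP[].
apply: eq_bigr => x; rewrite inE => /andP[_ xn].
have [_ _ _ /(_ x (eqP xn)) [h [[hH xh] huniq]]] := HP.
rewrite (big_pred1 h) // => h'; rewrite inE xn andbT.
by apply/andP/eqP => [[h'H xh']|->//]; rewrite (huniq h').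
Qed.

Lemma block_exists : exists h, h \in H.
Proof.
have [||x _ xn] := @rank_between _ _ _ rho_rank \bot%O \top%O n.+1.
- exact: le0x.
- by rewrite (rank_bot rho_rank) leq0n ltnW.
by have [_ _ _ /(_ x xn) [h [[hH _] _]]] := HP; exists h.
Qed.

(** In the paving lattice the low flats keep their lower covers, each block covers
the flats of rank n below it, and the top covers the blocks, because the blocks
are incomparable and have rank greater than n in L. *)
Lemma paving_rank_unique (rhoQ : L -> nat) :
    rank_function (paving_set rho n.+1 H) rhoQ ->
  {in paving_set rho n.+1 H, rhoQ =1 paving_rank}.
Proof.
case=> rmin rcov.
have low x : (rho x <= n)%N -> rhoQ x = rho x.
  have [m] := ubnP (rho x); elim: m x => // m IHm x xm xn.
  have [x0|x0] := posnP (rho x).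
    rewrite x0; apply: rmin; split=> [|z _]; first by rewrite in_paving_set xn.
    by rewrite (rank_eq0 rho_rank x0) ltx0.
  have bx : (\bot < x)%O.
    by rewrite lt0x; apply: contraTneq x0 => ->; rewrite (rank_bot rho_rank).
  have [y /andP[_ yx] xy] := lower_cover rho_rank bx.
  rewrite xy -(IHm y); [|lia|lia]; apply: rcov; split=> //.
  - by rewrite in_paving_set; apply/orP; left; lia.
  - by rewrite in_paving_set xn.
  by move=> z _; apply/negP => /andP[/(rank_lt rho_rank) ? /(rank_lt rho_rank)]; lia.
have block x : x \in H -> rhoQ x = n.+1.
  move=> xH; have xn := block_rank xH.
  have [||y /andP[_ yx] yn] := @rank_between _ _ _ rho_rank \bot%O x n.
  - exact: le0x.
  - by rewrite (rank_bot rho_rank) leq0n ltnW.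
  have {}yx : (y < x)%O.
    by rewrite lt_neqAle yx andbT; apply: contraTneq xn => <-; rewrite yn ltnn.
  rewrite -yn -low ?yn //; apply: rcov; split=> //.
  - by rewrite in_paving_set yn leqnn.
  - by rewrite in_paving_set xH orbT.
  move=> z; rewrite in_paving_set => /or3P[zn|zH|/eqP->]; apply/negP => /andP[yz zx].
  - by have := rank_lt rho_rank yz; lia.
  - by have := block_incomparable zH xH; rewrite zx.
  by rewrite lt1x in zx.
move=> x; rewrite in_paving_set => /or3P[xn|xH|/eqP->].
- by rewrite low // paving_rank_low.
- by rewrite block // paving_rank_block.
have [h hH] := block_exists; rewrite /paving_rank eqxx -(block h hH).
apply: rcov; split; rewrite ?in_paving_set ?hH ?eqxx ?orbT //.
  rewrite ltx1; apply: contraTneq hH => ->; by case: HP.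
move=> z; rewrite in_paving_set => /or3P[zn|zH|/eqP->]; apply/negP => /andP[hz zt].
- by have := rank_lt rho_rank hz; have := block_rank hH; lia.
- by have := block_incomparable hH zH; rewrite hz.
by rewrite ltxx in zt.
Qed.

Variables (C : numClosedFieldType) (t : C) (S : pred nat).

Local Notation f := (atoms_in rho C).
Local Notation layer := (layer f S t).

Let f_lt : forall i j, (i < j <= rho \top%O)%N -> f i < f j.
Proof.
by move=> i j; case: L_geometric => r_rk r_sm r_at; exact: atoms_in_lt.
Qed.

Let count_newton x k : (k <= rho \top%O)%N ->
  (count_below rho x k)%:R = newton f k (f (rho x)).
Proof.
case: L_geometric => r_rk r_sm r_at kN.
have [kx|xk] := leqP k (rho x); first exact: count_below_newton.
rewrite (count_below_gt rho_rank) // /newton (bigD1 (Ordinal xk)) //=.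
by rewrite subrr !mul0r.
Qed.

(** Without the bottom, which only contributes a factor 1 + t. *)
Definition low_flats : {set L} :=
  [set x | [&& (0 < rho x)%N, (rho x <= n)%N & S (rho x)]].

Lemma layer_flat m : (m < rho \top%O)%N -> layer m.+1 m.+1 =
  (if S m.+1 then t else 0)
    * \sum_(0 <= k < m.+1) newton f k (f m.+1) * layer k k.
Proof.
move=> mN; apply: layer_diag => i j ij; apply: (node_neq f_lt); lia.
Qed.

(** Grouping the chains by their largest element y, of rank k < rho x, and using that
the chains ending at y have total weight layer k k by induction. *)
Lemma chain_sum_low x : (0 < rho x)%N ->
  chain_sum t [set y in low_flats | (y < x)%O]
    = \sum_(0 <= k < minn (rho x) n.+1) newton f k (f (rho x)) * layer k k.
Proof.
have [m] := ubnP (rho x); elim: m x => // m IHm x xm x0; rewrite chain_sum_max.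
transitivity (1 + \sum_(y | (y <= x)%O && (0 < rho y < minn (rho x) n.+1)%N)
    layer (rho y) (rho y)).
  congr (1 + _); rewrite [LHS]big_mkcond [RHS]big_mkcond; apply: eq_bigr => y _.
  rewrite !inE leq_min !ltnS.
  have [y0|y0] := posnP (rho y); first by rewrite /= andbF.
  rewrite /=; case: (leqP (rho y) n) => yn; last by rewrite /= !andbF.
  have -> : (y <= x)%O && ((rho y < rho x)%N && true) = (y < x)%O.
    rewrite andbT; apply/andP/idP=> [[yx ryx]|yx].
      by rewrite lt_neqAle yx andbT; apply: contraTneq ryx => ->; rewrite ltnn.
    by rewrite ltW // (rank_lt rho_rank).
  case: (boolP (y < x)%O) => yx; last by rewrite andbF.
  have [k yk] : exists k, rho y = k.+1 by exists (rho y).-1; rewrite prednK.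
  have kN : (k < rho \top%O)%N by lia.
  rewrite andbT yk layer_flat //; case: (S k.+1) => /=; last by rewrite mul0r.
  congr (t * _); transitivity (chain_sum t [set z in low_flats | (z < y)%O]).
    congr (chain_sum t _); apply/setP => z; rewrite !inE -!andbA.
    case: (boolP (z < y)%O) => zy; rewrite ?andbF // !andbT (lt_trans zy yx).
    by rewrite !andbT.
  rewrite IHm //; last by have := rank_lt rho_rank yx; lia.
  by rewrite yk (minn_idPl _) //; lia.
rewrite big_ltn; last by rewrite leq_min x0.
rewrite /newton big_ord0 mul1r -/(newton _); congr (1 + _).
have E k : (1 <= k < minn (rho x) n.+1)%N ->
    newton f k (f (rho x)) * layer k k
      = \sum_(y | (y <= x)%O && (rho y == k)) layer k k.
  move=> kx; rewrite -count_newton; last by have := geq_minr (rho x) n.+1; lia.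
  rewrite /count_below -sum1_card natr_sum mulr_suml.
  by apply: eq_big => y; rewrite ?inE // mul1r.
rewrite [RHS](eq_big_nat _ _ E).
rewrite (exchange_big_dep (fun y => (y <= x)%O)) /=; last by move=> ? ? _ /andP[].
rewrite big_mkcondr; apply: eq_bigr => y yx.
under eq_bigl => k do rewrite yx eq_sym.
by rewrite big_nat1_eq.
Qed.

Definition inner_flats : {set L} := low_flats :|: (if S n.+1 then H else set0).

Lemma chain_sum_inner : chain_sum t inner_flats =
  \sum_(0 <= k < n.+1) newton f k (f (rho \top%O)) * layer k k
    + (if S n.+1 then t else 0)
      * \sum_(h in H) \sum_(0 <= k < n.+1) newton f k (f (rho h)) * layer k k.
Proof.
have wide x : (n < rho x)%N -> chain_sum t [set y in low_flats | (y < x)%O]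
    = \sum_(0 <= k < n.+1) newton f k (f (rho x)) * layer k k.
  by move=> nx; rewrite chain_sum_low ?(minn_idPr _) //; lia.
have below x : (x \in low_flats) || (x \in H) ->
    [set y in inner_flats | (y < x)%O] = [set y in low_flats | (y < x)%O].
  move=> xQ; apply/setP => y; rewrite !inE.
  case: (boolP (y < x)%O) => [yx|]; rewrite ?andbF // !andbT.
  have [Sn|] := boolP (S n.+1); last by rewrite inE orbF.
  apply: orb_idr => yH; case/orP: xQ => [|xH].
    by have := rank_lt rho_rank yx; have := block_rank yH; rewrite inE; lia.
  by have := block_incomparable yH xH; rewrite yx.
rewrite chain_sum_max.
rewrite (eq_bigl [predU low_flats & if S n.+1 then H else set0]); last first.
  by move=> x; rewrite !inE.
rewrite bigU /=; last first.
  rewrite -setI_eq0; apply/eqP/setP => x; rewrite !inE.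
  apply/negP => /andP[/and3P[_ xn _]]; case: ifP; rewrite ?inE // => _ /block_rank.
  lia.
rewrite addrA; congr (_ + _).
  rewrite -wide; last by lia.
  rewrite (_ : [set _ in _ | _] = low_flats); last first.
    apply/setP => x; rewrite inE andb_idr // inE ltx1 => /and3P[_ xn _].
    by apply: contraTneq xn => ->; rewrite -ltnNge; exact: ltnW.
  rewrite [RHS]chain_sum_max; congr (1 + _); apply: eq_bigr => x xl.
  by rewrite below ?xl.
case: (S n.+1); last by rewrite big_set0 mul0r.
rewrite mulr_sumr; apply: eq_bigr => h hH.
by rewrite below ?hH ?orbT // wide // block_rank.
Qed.

(** The bottom and the top are comparable to everything, so that each of them, if
selected, contributes a factor 1 + t, which does not vanish. *)
Lemma chain_sum_paving_neq0 : admissible t ->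
  chain_sum t (rank_select (paving_set rho n.+1 H) paving_rank S) != 0.
Proof.
move=> tP; set Q := rank_select _ _ _.
have t1 : 1 + t != 0.
  case: tP => [t0|[_ tu]]; last by apply: contraTneq tu => ->; rewrite mulr0 ltxx.
  apply: contraTneq t0 => /eqP; rewrite addrC addr_eq0 => /eqP ->.
  by rewrite raddfN /= (Creal_ImP _ _) ?oppr0 ?ltxx // rpred1.
have cone A x : x = \bot%O \/ x = \top%O ->
    chain_sum t (A :\ x) != 0 -> chain_sum t A != 0.
  move=> xE Ax; have [xA|xA] := boolP (x \in A); last first.
    by have -> : A = A :\ x by apply/esym/setDidPl; rewrite disjoint_sym disjoints1.
  rewrite (chain_sum_cone _ xA) ?mulf_neq0 // => y _.
  by case: xE => ->; rewrite /Order.comparable ?le0x ?lex1 ?orbT.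
apply: (cone _ \top%O); first by right.
apply: (cone _ \bot%O); first by left.
have -> : Q :\ \top%O :\ \bot%O = inner_flats.
  apply/setP => x; rewrite 2!in_setD1 [x \in Q]inE in_paving_set !inE.
  have bE : (x == \bot%O) = (rho x == 0%N).
    apply/eqP/eqP => [->|/(rank_eq0 rho_rank)//]; exact: rank_bot.
  rewrite bE -lt0n; have [xn|xn] := leqP (rho x) n.
    have -> : (x \in if S n.+1 then H else set0) = false.
      by case: ifP => _; rewrite ?inE //; apply/negP => /block_rank; lia.
    rewrite orbF paving_rank_low //=; have -> // : x != \top%O.
    by apply: contraTneq xn => ->; rewrite -ltnNge; exact: ltnW.
  rewrite andbF /= (leq_ltn_trans _ xn) //=.
  have [->|xt] := eqVneq x \top%O.
    by apply/esym/negP; case: ifP; rewrite ?inE // => _; apply/negP; case: HP.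
  rewrite orbF /=; have [xH|xH] := boolP (x \in H).
    by rewrite paving_rank_block //; case: (S n.+1); rewrite ?xH ?inE.
  by case: (S n.+1); rewrite ?(negPf xH) ?inE.
rewrite chain_sum_inner.
apply: (@paving_sum_neq0 _ _ _ _ (rho \top%O)) => //.
- by lia.
- by rewrite /atoms_in (atoms_below0 rho_rank).
- by move=> h hH; rewrite block_rank // (rank_top rho_rank).
rewrite -count_newton; last exact: ltnW.
rewrite -count_blocks natr_sum; apply: eq_bigr => h _; rewrite count_newton //.
exact: ltnW.
Qed.

End Paving.

Section RealRoots.

Variables (R : realType) (disp : Order.disp_t) (T : finPOrderType disp).

(** Nonreal zeros come in conjugate pairs, so that the upper half-plane suffices. *)
Lemma zeros_of_chain_poly (A : {set T}) :
    (forall t : R[i], admissible t -> chain_sum t A != 0) ->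
  real_rooted (chain_poly R A) /\ zeros_between (-1) 0 (chain_poly R A).
Proof.
move=> nz; split=> [z|x]; rewrite /root.
  rewrite (horner_chain_poly (real_complex R)) => /eqP z0.
  have [Iz|Iz|//] := ltgtP (complex.Im z) 0.
    have /eqP[] : chain_sum z^* A != 0.
      apply: nz; left; rewrite Im_conj -complexIm oppr_gt0.
      by rewrite (ltcR (complex.Im z) 0).
    transitivity (chain_sum z A)^*; last by rewrite z0 rmorph0.
    by rewrite rmorph_sum; apply: eq_bigr => D _; rewrite rmorphXn.
  have /eqP[] : chain_sum z A != 0 by apply: nz; left; rewrite -complexIm ltcR.
  exact: z0.
move=> x0; have : (map_poly (real_complex R) (chain_poly R A)).[(x%:C)%C] == 0.
  by rewrite horner_map (eqP x0) rmorph0.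
rewrite horner_chain_poly; apply: contraTT => x01.
apply: nz; right; split; first exact/complex_realP/ex_intro.
have -> : (x%:C)%C * (1 + (x%:C)%C) = ((x * (1 + x))%:C)%C.
  by rewrite rmorphM rmorphD rmorph1.
rewrite ltcR; move: x01; rewrite negb_and -!ltNge => /orP[?|?]; nra.
Qed.

End RealRoots.

Theorem theorem5p9 (R : realType) (disp : Order.disp_t)
    (L : finTBLatticeType disp) (rho : L -> nat)
    (L_geometric : geometric_lattice rho) (L_uniform : rank_uniform rho)
    (Q : {set L}) (Q_paving : paving_lattice rho Q) :
  (real_rooted (chain_poly R Q) /\
   zeros_between (-1)%R 0%R (chain_poly R Q)) /\
  (forall rhoQ : L -> nat, rank_function Q rhoQ ->
   forall S : pred nat,
     real_rooted (chain_poly R (rank_select Q rhoQ S)) /\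
     zeros_between (-1)%R 0%R (chain_poly R (rank_select Q rhoQ S))).
Proof.
have [d [H [/andP[d_gt0 dN] HP ->]]] := Q_paving.
case: d d_gt0 dN HP => // n _ nN HP.
have selected S := zeros_of_chain_poly (fun t =>
  @chain_sum_paving_neq0 _ L rho L_geometric L_uniform n H nN HP R[i] t S).
split=> [|rhoQ rhoQ_rank S].
  have -> : paving_set rho n.+1 H
      = rank_select (paving_set rho n.+1 H) (paving_rank rho n H) predT.
    by apply/setP => x; rewrite [RHS]inE andbT.
  exact: selected.
have -> // : rank_select (paving_set rho n.+1 H) rhoQ S
  = rank_select (paving_set rho n.+1 H) (paving_rank rho n H) S.
apply/setP => x; rewrite inE [RHS]inE; apply: andb_id2l => xQ.
by rewrite (paving_rank_unique L_geometric nN HP rhoQ_rank xQ).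
Qed.
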